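(* Let $b>0$ and let $X_1,X_2,\dots$ be independent random variables such that $\mathbb{E}[X_i]=0$, $\mathbb{E}[|X_i|^2]\le\sigma_i^2$ and $X_i\le b$ (almost surely) for $i\in\mathbb{N}$. Define $S_n=\sum_{i=1}^nX_i$, $\nu_n=\frac1n\sum_{i=1}^n\sigma_i^2$, and \[ \mathcal{V}(s,n)=n\ln\Big[\frac{b^2}{b^2+\nu_n}\exp\Big(-\frac{\nu_n}{b}s\Big)+\frac{\nu_n}{b^2+\nu_n}e^{bs}\Big] \] for $n\in\mathbb{N}$. Let $m$ be a positive integer with $\nu_m>0$. Then for $0<\varepsilon<b$, \[ \Pr\Big\{\sup_{n\in\mathbb{N}}\big[\zeta(S_n-m\varepsilon)-\mathcal{V}(\zeta,n)+\mathcal{V}(\zeta,m)\big]\ge0\Big\}\le\Big[\Big(1+\frac{b\varepsilon}{\nu_m}\Big)^{-\frac{\nu_m+b\varepsilon}{b^2+\nu_m}}\Big(1-\frac{\varepsilon}{b}\Big)^{-\frac{b^2-b\varepsilon}{b^2+\nu_m}}\Big]^m, \] where $\zeta=\frac{b}{b^2+\nu_m}\ln\frac{1+\frac{\varepsilon b}{\nu_m}}{1-\frac{\varepsilon}{b}}$.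
   Context: $\mathbb{N}$ denotes the set of positive integers. *)

(* Defs.v *)
From HB Require Import structures.
From mathcomp Require Import all_boot all_order all_algebra.
From mathcomp Require Import all_classical all_reals all_analysis.
Set Implicit Arguments. Unset Strict Implicit. Unset Printing Implicit Defensive.
Import Order.TTheory GRing.Theory Num.Theory.
Local Open Scope classical_set_scope.
Local Open Scope ring_scope.

Definition mutually_independent (R : realType) (d : measure_display)
  (T : measurableType d) (P : probability T R) (X : nat -> T -> R) : Prop :=
  forall (J : seq nat) (B : nat -> set R), uniq J ->
    (forall j, j \in J -> measurable (B j)) ->
    P (\bigcap_(j in [set` J]) (X j @^-1` B j)) =
    (\prod_(j <- J) P (X j @^-1` B j))%E.

(* nu_n = (1/n) sum_{i=1}^n sigma_i^2, with sigma_i stored at index i-1 *)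
Definition nu (R : realType) (sigma : nat -> R) (n : nat) : R :=
  n%:R^-1 * \sum_(i < n) sigma i ^+ 2.

Definition calV (R : realType) (b : R) (sigma : nat -> R) (s : R) (n : nat) : R :=
  n%:R * ln (b ^+ 2 / (b ^+ 2 + nu sigma n) * expR (- (nu sigma n / b) * s)
             + nu sigma n / (b ^+ 2 + nu sigma n) * expR (b * s)).

(* Main.v *)
Require Import Defs.
From HB Require Import structures.
From mathcomp Require Import all_boot all_order all_algebra.
From mathcomp Require Import all_classical all_reals all_analysis.
From mathcomp Require Import measurable_realfun ring lra.
Import Order.TTheory GRing.Theory Num.Theory.
Import numFieldNormedType.Exports.
Local Open Scope classical_set_scope.
Local Open Scope ring_scope.

(** With [g v] the moment generating function at [zeta] of the centred two-point
law on [{- v / b, b}] of variance [v], Bennett's inequality gives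
[E exp (zeta X_i) <= g (sigma_i ^+ 2)].  Since [ln g] is concave,
[n ln g (nu_n) + ln g (sigma_(n+1) ^+ 2) <= (n + 1) ln g (nu_(n+1))], hence
[exp (zeta S_n - V (zeta, n))] is a nonnegative supermartingale started at 1, and
Ville's maximal inequality bounds the probability by
[exp (V (zeta, m) - m eps zeta)].  The given [zeta] minimises this bound, which
then equals the right-hand side. *)

(** * Exponential inequalities and log-concavity in the variance *)

Section calculus.
Context {R : realType}.
Implicit Types (f df : R -> R) (t u x y : R).

Lemma is_derive_MVT f df (a b : R) : a <= b ->
  (forall x, a <= x <= b -> is_derive x 1 f (df x)) ->
  exists2 c, a <= c <= b & f b - f a = df c * (b - a).
Proof.
move=> ab fd.
have [||c cab fE] := @MVT_segment R f df a b ab.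
- by move=> x /[!in_itv]/= /andP[/ltW ax /ltW xb]; apply: fd; rewrite ax xb.
- apply: derivable_within_continuous => x /[!in_itv]/= xab.
  by have [] := fd x xab.
- by exists c => //; move: cab; rewrite in_itv.
Qed.

Lemma ge0_is_derive f df : 0 <= f 0 ->
  (forall x, 0 <= x -> is_derive x 1 f (df x)) ->
  (forall x, 0 <= x -> 0 <= df x) -> forall x, 0 <= x -> 0 <= f x.
Proof.
move=> f0 fd df0 x x0.
have [y /andP[y0 _]|c /andP[c0 _] fE] := @is_derive_MVT f df 0 x x0.
  exact: fd.
by rewrite -(subrK (f 0) (f x)) fE subr0 addr_ge0 // mulr_ge0 // df0.
Qed.

(** The mean value theorem is used twice: on [df], to see that it is nonincreasing on the half-line,
    then on [f] between [x] and [z]. The tangent form makes Jensen a mere sum of lines. *)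
Lemma concave_is_derive2 f df (d2f : R -> R) :
  (forall x, 0 <= x -> is_derive x 1 f (df x)) ->
  (forall x, 0 <= x -> is_derive x 1 df (d2f x)) ->
  (forall x, 0 <= x -> d2f x <= 0) ->
  forall z x, 0 <= z -> 0 <= x -> f x <= f z + df z * (x - z).
Proof.
move=> fd dfd d2f0.
have mono x y : 0 <= x -> x <= y -> df y <= df x.
  move=> x0 xy; have [z /andP[xz _]|c /andP[xc _] E] := @is_derive_MVT df d2f x y xy.
    by apply: dfd; exact: le_trans xz.
  by rewrite -subr_le0 E mulr_le0_ge0 ?subr_ge0// d2f0// (le_trans x0).
move=> z x z0 x0; have [zx|/ltW xz] := leP z x.
- have [y /andP[zy _]|c /andP[zc _] E] := @is_derive_MVT f df z x zx.
    by apply: fd; exact: le_trans zy.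
  rewrite addrC -lerBlDr E ler_wpM2r ?subr_ge0//; exact: mono.
- have [y /andP[xy _]|c /andP[xc cz] E] := @is_derive_MVT f df x z xz.
    by apply: fd; exact: le_trans xy.
  have := mono c z (le_trans x0 xc) cz => H.
  have : df z * (z - x) <= df c * (z - x) by rewrite ler_wpM2r ?subr_ge0.
  rewrite -E; lra.
Qed.

Lemma expR_ge_quadratic x : 0 <= x -> 1 + x + x ^+ 2 / 2 <= expR x.
Proof.
move=> x0; rewrite -subr_ge0.
pose f (y : R) := expR y - (1 + y + y ^+ 2 / 2).
apply: (@ge0_is_derive f (fun y => expR y - (1 + y))) => //.
- by rewrite /f expR0; lra.
- move=> y _; rewrite /f; apply: is_derive_eq; rewrite /GRing.scale /=; lra.
- by move=> y _; rewrite subr_ge0 expR_ge1Dx.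
Qed.

Lemma expRN_le_quadratic x : 0 <= x -> expR (- x) <= 1 - x + x ^+ 2 / 2.
Proof.
move=> x0; rewrite -subr_ge0.
pose f (y : R) := 1 - y + y ^+ 2 / 2 - expR (- y).
apply: (@ge0_is_derive f (fun y => expR (- y) - (1 - y))) => //.
- by rewrite /f oppr0 expR0; lra.
- move=> y _; rewrite /f; apply: is_derive_eq; rewrite /GRing.scale /=; lra.
- by move=> y _; rewrite subr_ge0 expR_ge1Dx.
Qed.

(** After division by [2 * expR x] this is [x <= sinh x]. *)
Lemma expR_sqr_ge x : 0 <= x -> 1 + 2 * x * expR x <= expR x ^+ 2.
Proof.
move=> x0; rewrite -subr_ge0.
pose f (y : R) := expR y ^+ 2 - (1 + 2 * y * expR y).
apply: (@ge0_is_derive f (fun y => 2 * expR y * (expR y - (1 + y)))) => //.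
- by rewrite /f expR0; lra.
- move=> y _; rewrite /f; apply: is_derive_eq; rewrite /GRing.scale /=; ring.
- by move=> y _; rewrite !mulr_ge0 ?expR_ge0// subr_ge0 expR_ge1Dx.
Qed.

Lemma expR_chord (a x : R) : 0 <= a <= 1 -> 0 <= x ->
  expR (a * x) <= a * expR x + (1 - a).
Proof.
move=> /andP[a0 a1] x0; rewrite -subr_ge0.
pose f (y : R) := a * expR y + (1 - a) - expR (a * y).
apply: (@ge0_is_derive f (fun y => a * (expR y - expR (a * y)))) => //.
- by rewrite /f mulr0 expR0; lra.
- move=> y _; rewrite /f; apply: is_derive_eq; rewrite /GRing.scale /=; ring.
- by move=> y y0; rewrite mulr_ge0 // subr_ge0 ler_expR ler_piMl.
Qed.

(* Monotonicity of [(expR u - 1 - u) / u ^+ 2], free of the division at [u = 0]. *)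
Lemma expR_remainder_le u x : u <= x -> 0 < x ->
  x ^+ 2 * (expR u - 1 - u) <= u ^+ 2 * (expR x - 1 - x).
Proof.
move=> ux x0; have [u0|/ltW u0] := leP 0 u; last first.
  (* For [u <= 0] the value [1 / 2] separates the two quotients: the quadratic bounds give
     [expR u - 1 - u <= u ^+ 2 / 2] and [x ^+ 2 / 2 <= expR x - 1 - x]. *)
  have h1 := @expRN_le_quadratic (- u); rewrite opprK sqrrN oppr_ge0 in h1.
  have h2 := @expR_ge_quadratic x (ltW x0).
  have x2 : 0 <= x ^+ 2 by exact: sqr_ge0.
  have u2 : 0 <= u ^+ 2 by exact: sqr_ge0.
  have h3 := ler_wpM2l x2 (h1 u0); have h4 := ler_wpM2l u2 h2.
  nra.
(* For [0 <= u] fix the ratio [a] and let [x] vary: the derivative of the gap is [a] times the gap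
   between the exponential and its chord. *)
pose a := u / x.
have a01 : 0 <= a <= 1 by rewrite divr_ge0 ?(ltW x0)//= ler_pdivrMr // mul1r.
have uE : u = a * x by rewrite /a divfK ?gt_eqF.
pose f (y : R) := a ^+ 2 * (expR y - 1 - y) - (expR (a * y) - 1 - a * y).
have : 0 <= f x.
  apply: (@ge0_is_derive f (fun y => a * (a * expR y + (1 - a) - expR (a * y)))).
  - by rewrite /f mulr0 expR0; lra.
  - move=> y _; rewrite /f; apply: is_derive_eq; rewrite /GRing.scale /=; ring.
  - move=> y y0; have /andP[a0 _] := a01.
    by rewrite mulr_ge0 // subr_ge0 expR_chord.
  - exact: ltW.
rewrite /f -uE subr_ge0 => h.
have -> : u ^+ 2 = x ^+ 2 * a ^+ 2 by rewrite {1}uE; ring.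
by rewrite -mulrA ler_wpM2l // sqr_ge0.
Qed.

(** With [w = v / b ^+ 2] and [t = b * s] the function is [ln (bennett b s v)], so these supporting
    lines express its concavity in the variance. The second derivative is computed and shown
    nonpositive. *)
Lemma ln_two_point_tangent (t : R) : 0 <= t ->
  exists df : R -> R, forall z w, 0 <= z -> 0 <= w ->
  let f w := ln ((expR (- (w * t)) + w * expR t) / (1 + w)) in
  f w <= f z + df z * (w - z).
Proof.
move=> t0.
pose N (w : R) := expR (- (w * t)) + w * expR t.
pose N1 (w : R) := expR t - t * expR (- (w * t)).
pose N2 (w : R) := t ^+ 2 * expR (- (w * t)).
have N0 (w : R) : 0 <= w -> 0 < N w.
  by move=> w0; rewrite ltr_wpDr ?expR_gt0// mulr_ge0 ?expR_ge0.
have NN1 (w : R) : is_derive w 1 N (N1 w).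
  by rewrite /N; apply: is_derive_eq; rewrite /GRing.scale/= /N1; ring.
have NN2 (w : R) : is_derive w 1 N1 (N2 w).
  by rewrite /N1; apply: is_derive_eq; rewrite /GRing.scale/= /N2; ring.
have D1 (w : R) : is_derive w 1 (fun w : R => 1 + w) 1.
  by apply: is_derive_eq; rewrite add0r mulr1.
pose df (w : R) := N1 w / N w - (1 + w)^-1.
pose f (w : R) := ln (N w) - ln (1 + w).
exists df => z w z0 w0.
have lnE v : 0 <= v -> ln (N v / (1 + v)) = f v.
  by move=> v0; rewrite ln_div // posrE ?N0//; lra.
rewrite /= !lnE //.
pose d2f (w : R) := (N2 w * N w - N1 w ^+ 2) / N w ^+ 2 + (1 + w) ^- 2.
apply: (concave_is_derive2 f df d2f _ _ _ z w z0 w0).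
- move=> {lnE z w z0 w0} w w0; rewrite /f.
  have dlnN := is_derive1_comp (is_derive1_ln (N0 w w0)) (NN1 w).
  have w1 : 0 < 1 + w by lra.
  have dln1 := is_derive1_comp (is_derive1_ln w1) (D1 w).
  by apply: (is_derive_eq (is_deriveB dlnN dln1)); rewrite /df; ring.
- move=> {lnE z w z0 w0} w w0; rewrite /df.
  have w1 : 1 + w != 0 by rewrite gt_eqF //; lra.
  have Nw : N w != 0 by rewrite gt_eqF // N0.
  have dN := is_deriveM (NN2 w) (is_deriveV Nw (NN1 w)).
  have d1 := is_deriveV w1 (D1 w).
  apply: (is_derive_eq (is_deriveB dN d1)); rewrite /d2f /GRing.scale/=; field.
  by rewrite w1 Nw.
- move=> {lnE z w z0 w0} w w0.
  (* In terms of [y] the factor [E ^+ 2] comes out, and what remains is a nonnegative combination of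
     the gaps in [expR_sqr_ge] and [expR_ge_quadratic]. *)
  pose y := (1 + w) * t; have y0 : 0 <= y by rewrite mulr_ge0 //; lra.
  pose E := expR (- (w * t)); pose G := expR y.
  have FE : expR t = E * G by rewrite /E /G -expRD; congr expR; rewrite /y; ring.
  have key : 0 <= (1 + w) ^+ 2 * (N1 w ^+ 2 - N2 w * N w) - N w ^+ 2.
    have -> : (1 + w) ^+ 2 * (N1 w ^+ 2 - N2 w * N w) - N w ^+ 2 =
      E ^+ 2 * ((G ^+ 2 - (1 + 2 * y * G))
                + 2 * w * G * (G - (1 + y + y ^+ 2 / 2))).
      by rewrite /N1 /N2 /N FE -/E /y; field.
    rewrite mulr_ge0 ?sqr_ge0// addr_ge0// ?subr_ge0 ?expR_sqr_ge//.
    by rewrite !mulr_ge0 ?expR_ge0// subr_ge0 expR_ge_quadratic.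
  have w1 : 0 < 1 + w by lra.
  have Nw := N0 w w0; rewrite /d2f.
  have -> : (N2 w * N w - N1 w ^+ 2) / N w ^+ 2 + (1 + w) ^- 2 =
    - (((1 + w) ^+ 2 * (N1 w ^+ 2 - N2 w * N w) - N w ^+ 2)
       / (N w ^+ 2 * (1 + w) ^+ 2)).
    by field; rewrite !gt_eqF.
  by rewrite oppr_le0 divr_ge0 // mulr_ge0 ?sqr_ge0.
Qed.

End calculus.

(* Moment generating function at [s] of the centred law on [{- v / b, b}] of
   variance [v]. *)
Definition bennett {R : realType} (b s v : R) : R :=
  b ^+ 2 / (b ^+ 2 + v) * expR (- (v / b) * s) + v / (b ^+ 2 + v) * expR (b * s).

(** * Properties of the two-point moment generating function *)

Section bennett.
Context {R : realType} (b s : R) (b0 : 0 < b) (s0 : 0 <= s).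
Implicit Types (v x y z : R) (sigma : nat -> R).

Let b20 : 0 < b ^+ 2. Proof. exact: exprn_gt0. Qed.

Lemma bennett_gt0 v : 0 <= v -> 0 < bennett b s v.
Proof.
move=> v0; have bv : 0 < b ^+ 2 + v by rewrite ltr_wpDr.
by rewrite ltr_wpDr ?mulr_gt0 ?mulr_ge0 ?expR_gt0 ?expR_ge0 ?invr_gt0 ?invr_ge0 // ltW.
Qed.

(** Jensen with weights [n] and [1]: both values are bounded by the supporting line at the mean [z],
    and the linear terms cancel in the weighted sum. *)
Lemma ln_bennett_concave (n x y z : R) : 0 <= n -> 0 <= x -> 0 <= y ->
  (n + 1) * z = n * x + y ->
  n * ln (bennett b s x) + ln (bennett b s y) <= (n + 1) * ln (bennett b s z).
Proof.
move=> n0 x0 y0 zE.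
have n1 : 0 < n + 1 by lra.
have z0 : 0 <= z by rewrite -(pmulr_rge0 _ n1) zE addr_ge0 // mulr_ge0.
have [df H] := ln_two_point_tangent _ (mulr_ge0 (ltW b0) s0).
have benE v : 0 <= v -> bennett b s v = (expR (- (v / b ^+ 2 * (b * s)))
    + v / b ^+ 2 * expR (b * s)) / (1 + v / b ^+ 2).
  move=> v0; rewrite /bennett.
  have -> : - (v / b) * s = - (v / b ^+ 2 * (b * s)) by field; rewrite gt_eqF.
  by field; rewrite !gt_eqF // ltr_wpDr.
have scl v : 0 <= v -> 0 <= v / b ^+ 2 by move=> v0; rewrite divr_ge0 // ltW.
rewrite !benE //.
have Hx := ler_wpM2l n0 (H _ _ (scl z z0) (scl x x0)).
have Hy := H _ _ (scl z z0) (scl y y0).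
apply: le_trans (lerD Hx Hy) _.
set L := ln _; set D := df _; rewrite le_eqVlt; apply/orP; left; apply/eqP.
have -> : y = (n + 1) * z - n * x by rewrite zE; ring.
by field; rewrite gt_eqF.
Qed.

Lemma nu_ge0 sigma n : 0 <= nu sigma n.
Proof. by rewrite mulr_ge0 ?invr_ge0 // sumr_ge0 // => i _; exact: sqr_ge0. Qed.

(** This is what makes the process a supermartingale: [nu sigma n.+1] is the mean of [nu sigma n]
    and [sigma n ^+ 2] with weights [n] and [1]. *)
Lemma calV_increment sigma n :
  calV b sigma s n + ln (bennett b s (sigma n ^+ 2)) <= calV b sigma s n.+1.
Proof.
rewrite /calV -!/(bennett b s _) -natr1.
apply: ln_bennett_concave; rewrite ?nu_ge0 ?sqr_ge0 //.
rewrite natr1 /nu !mulrA mulfV ?pnatr_eq0// mul1r big_ord_recr/=.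
(* The factor [n%:R / n%:R] is [1] only for positive [n]; for [n = 0] the sum it multiplies is
   empty. *)
have [->|n0] := posnP n; first by rewrite big_ord0 !mul0r.
by rewrite mulfV ?mul1r // pnatr_eq0 -lt0n.
Qed.

(* The parabola tangent to [expR (s * x)] at [- v / b] and meeting it again at
   [b] dominates the exponential on [x <= b]; [bennett b s v] is its mean. *)
Lemma expR_le_parabola v x : 0 < s -> 0 <= v -> x <= b ->
  expR (s * x) <= expR (- (v / b) * s) * (1 + s * (x + v / b) +
    (expR (s * (b + v / b)) - 1 - s * (b + v / b)) / (b + v / b) ^+ 2 *
    (x + v / b) ^+ 2).
Proof.
move=> s_gt0 v0 xb; set a := v / b; set K := expR (s * (b + a)) - 1 - s * (b + a).
have a0 : 0 <= a by rewrite divr_ge0 // ltW.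
have ba : 0 < b + a by exact: ltr_pwDl.
have -> : s * x = - a * s + s * (x + a) by ring.
rewrite expRD ler_pM2l ?expR_gt0 //.
have := @expR_remainder_le R (s * (x + a)) (s * (b + a)).
rewrite -/K ler_pM2l // lerD2r => /(_ xb); rewrite mulr_gt0 // => /(_ isT).
rewrite -ler_pdivlMl ?exprn_gt0 ?mulr_gt0 // => h.
have -> : K / (b + a) ^+ 2 * (x + a) ^+ 2 =
    (s * (b + a)) ^- 2 * ((s * (x + a)) ^+ 2 * K).
  by field; rewrite !gt_eqF.
by rewrite -lerBlDl opprD addrA.
Qed.

End bennett.

(** * Bennett's bound for one variable *)

Section moment_generating_function.
Context {R : realType} {d : measure_display} {T : measurableType d}.
Context (P : probability T R) (X : {RV P >-> R}) (b s v : R).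
Hypotheses (b0 : 0 < b) (s0 : 0 < s).
Hypotheses (EX : ('E_P[X] = 0)%E).
Hypotheses (EX2 : (\int[P]_x ((`|X x| ^+ 2)%:E) <= v%:E)%E).
Hypotheses (Xb : {ae P, forall x, X x <= b}).

Let v0 : 0 <= v.
Proof.
rewrite -lee_fin; apply: le_trans EX2; apply: integral_ge0 => x _.
by rewrite lee_fin sqr_ge0.
Qed.

Let iX2 : P.-integrable setT (fun x => (X x ^+ 2)%:E).
Proof.
apply/integrableP; split; first by apply/measurable_EFinP; exact: measurable_funX.
apply: le_lt_trans (ltry v); apply: le_trans EX2.
by under eq_integral do rewrite /= ger0_norm ?sqr_ge0 // -real_normK ?num_real //.
Qed.

(** Domination by [1 + X ^+ 2], which follows from the sign of [(w - 1) ^+ 2] with [w] the absolute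
    value of [X x]. *)
Let iX : P.-integrable setT (EFin \o X).
Proof.
have i1 : P.-integrable setT (EFin \o cst 1) by exact: finite_measure_integrable_cst.
apply: le_integrable (integrableD measurableT i1 iX2) => //.
  exact/measurable_EFinP.
move=> x _ /=; rewrite lee_fin (@ger0_norm _ (1 + _)) ?addr_ge0 ?sqr_ge0 //.
rewrite -(@real_normK _ (X x)) ?num_real //; set w := `|X x|.
have w0 : 0 <= w by exact: normr_ge0.
have := sqr_ge0 (w - 1); nra.
Qed.

(** The dominating parabola is integrated: its linear term vanishes as [X] is centred, and its mean
    depends only on the second moment. It meets the exponential at both atoms of the two-point law,
    hence the value [bennett b s v]. *)
Lemma mgf_le_bennett : (\int[P]_x (expR (s * X x))%:E <= (bennett b s v)%:E)%E.
Proof.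
set a := v / b; have a0 : 0 <= a by rewrite divr_ge0 // ltW.
have ba : 0 < b + a by exact: ltr_pwDl.
pose C := (expR (s * (b + a)) - 1 - s * (b + a)) / (b + a) ^+ 2.
(* This keeps the parabola nonnegative everywhere, even on the null set where [X] exceeds [b], as
   the comparison of integrals demands. *)
have C_ge : s ^+ 2 / 2 <= C.
  rewrite ler_pdivlMr ?exprn_gt0 //.
  have := expR_ge_quadratic _ (mulr_ge0 (ltW s0) (ltW ba)).
  by set E := expR _; rewrite exprMn; lra.
have C0 : 0 <= C by apply: le_trans C_ge; rewrite mulr_ge0 ?sqr_ge0.
pose A := expR (- a * s).
pose c0 := A * (1 + s * a + C * a ^+ 2); pose c1 := A * (s + 2 * C * a); pose c2 := A * C.
have qE x : A * (1 + s * (x + a) + C * (x + a) ^+ 2) = c0 + (c1 * x + c2 * x ^+ 2).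
  by rewrite /c0 /c1 /c2; ring.
have i0 : P.-integrable setT (EFin \o cst c0) by exact: finite_measure_integrable_cst.
have i1 : P.-integrable setT (fun x => c1%:E * (X x)%:E)%E by exact: integrableZl.
have i2 : P.-integrable setT (fun x => c2%:E * (X x ^+ 2)%:E)%E by exact: integrableZl.
apply: (@le_trans _ _ (\int[P]_x (c0%:E + (c1%:E * (X x)%:E + c2%:E * (X x ^+ 2)%:E)))%E).
  apply: ae_ge0_le_integral => //.
  - by apply/measurable_EFinP; apply: measurableT_comp => //; exact: measurable_funM.
  - move=> y _; rewrite -!EFinM -!EFinD lee_fin -qE mulr_ge0 ?expR_ge0 //.
    have := ler_wpM2r (sqr_ge0 (X y + a)) C_ge.
    by have := sqr_ge0 (s * (X y + a) + 1); rewrite sqrrD1 exprMn; lra.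
  - by apply: measurable_int (integrableD _ i0 (integrableD _ i1 i2)).
  - move: Xb; apply: filterS => x xb _; rewrite -!EFinM -!EFinD lee_fin -qE.
    exact: expR_le_parabola.
rewrite integralD //; last exact: integrableD.
rewrite integralD // !integralZl //.
rewrite integral_cst //= probability_setT mule1.
have -> : (\int[P]_x (X x)%:E)%E = 0%E by rewrite -EX expectation_def.
rewrite mule0 add0e.
(* The second moment is only bounded by [v], so the sign of its coefficient matters. *)
have c20 : 0 <= c2 by rewrite mulr_ge0 ?expR_ge0.
apply: (@le_trans _ _ (c0%:E + c2%:E * v%:E)%E).
  rewrite leeD2l // lee_wpmul2l ?lee_fin //.
  by under eq_integral do rewrite -real_normK ?num_real //.
rewrite -EFinM -EFinD lee_fin /c0 /c2 /bennett.
have -> : expR (b * s) = A * expR (s * (b + a)).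
  by rewrite /A -expRD; congr expR; ring.
rewrite -/a -/A /C; set E := expR (s * (b + a)).
rewrite le_eqVlt; apply/orP; left; apply/eqP.
rewrite /a; field.
by rewrite !gt_eqF // ltr_wpDr ?exprn_gt0.
Qed.

End moment_generating_function.

(** * Independence of the past and product expectations *)

Section independence.
Context {R : realType} {d : measure_display} {T : measurableType d}.
Context (P : probability T R).
Local Open Scope ereal_scope.

(** Both sides are finite measures in [A] that agree on the pi-system [G], hence on the
    sigma-algebra it generates; the constant sequence [setT] exhausts the space. *)
Lemma indep_g_sigma_algebra (G : set (set T)) (C : set T) :
  G `<=` measurable -> setI_closed G -> G setT -> measurable C ->
  (forall A, G A -> P (A `&` C) = P A * P C) ->
  forall A, <<s G >> A -> P (A `&` C) = P A * P C.
Proof.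
move=> Gm GI GT mC GC A sGA.
have PC0 : (0 <= fine (P C))%R by rewrite fine_ge0.
rewrite muleC -(@fineK _ (P C)) ?fin_num_measure //.
change (mrestr P mC A = mscale (NngNum PC0) P A).
apply: (g_sigma_algebra_measure_unique G Gm (fun=> setT)) => //.
- by apply/seteqP; split => // x _; exists 0%N.
- move=> B /GC PBC; change (P (B `&` C) = (fine (P C))%:E * P B).
  by rewrite PBC fineK ?fin_num_measure // muleC.
- move=> _; change (P (setT `&` C) < +oo).
  by rewrite (le_lt_trans (probability_le1 _ _)) ?ltry // setTI.
Qed.

(** The joint law of [(F, G)] is the product of the marginal laws by uniqueness of product measures;
    Tonelli then separates the integral. *)
Lemma indep_integralM (F G : T -> R) :
  measurable_fun setT F -> measurable_fun setT G ->
  (forall x, 0 <= F x)%R -> (forall x, 0 <= G x)%R ->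
  (forall A B, measurable A -> measurable B ->
    P (F @^-1` A `&` G @^-1` B) = P (F @^-1` A) * P (G @^-1` B)) ->
  \int[P]_x (F x * G x)%:E = (\int[P]_x (F x)%:E) * (\int[P]_x (G x)%:E).
Proof.
move=> mF mG F0 G0 FG.
pose F' : {mfun T >-> R} := HB.pack F (isMeasurableFun.Build _ _ _ _ _ mF).
pose G' : {mfun T >-> R} := HB.pack G (isMeasurableFun.Build _ _ _ _ _ mG).
pose H x := (F x, G x).
have mH : measurable_fun setT H by exact: measurable_fun_pair.
pose H' : {mfun T >-> (R * R)%type} := HB.pack H (isMeasurableFun.Build _ _ _ _ _ mH).
(* The positive part makes the integrand nonnegative on the whole plane, as Tonelli needs, and
   changes nothing at the values of [F] and [G]. *)
pose pos (u : R) : R := Num.max u 0%R.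
pose mulmax (z : R * R) : \bar R := (pos z.1 * pos z.2)%:E.
have maxE (u : R) : (0 <= u)%R -> pos u = u by move=> /max_idPl.
have max0 (u : R) : (0 <= pos u)%R by rewrite /pos le_max lexx orbT.
have mulmax0 z : 0 <= mulmax z by rewrite lee_fin mulr_ge0.
have mmax : measurable_fun setT pos.
  by apply: measurable_maxr.
have mmul : measurable_fun setT mulmax.
  apply/measurable_EFinP; apply: measurable_funM; exact: measurableT_comp mmax _.
transitivity (\int[distribution P H']_z mulmax z).
  rewrite ge0_integral_distribution //.
  by apply: eq_integral => x _; rewrite /= /mulmax/= !maxE.
transitivity (\int[distribution P F' \x distribution P G']_z mulmax z).
  apply: eq_measure_integral => A mA _.
  by apply/esym/product_measure_unique => // B C mB mC; rewrite -FG.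
rewrite fubini_tonelli1 // /fubini_F.
have E u : \int[distribution P G']_y mulmax (u, y) =
    (pos u)%:E * \int[P]_x (G x)%:E.
  rewrite /mulmax/=; under eq_integral do rewrite EFinM.
  rewrite ge0_integralZl_EFin //.
  - rewrite ge0_integral_distribution //.
    + by congr (_ * _); apply: eq_integral => x _ /=; rewrite maxE.
    + by apply/measurable_EFinP.
    + by move=> y; rewrite lee_fin.
  - by apply/measurable_EFinP.
under eq_integral do rewrite E.
rewrite ge0_integralZr //.
- rewrite ge0_integral_distribution //.
  + by congr (_ * _); apply: eq_integral => x _ /=; rewrite maxE.
  + by apply/measurable_EFinP.
- by apply/measurable_EFinP.
- by move=> y _; rewrite lee_fin.
- by apply: integral_ge0 => x _; rewrite lee_fin.
Qed.

(** Generators of the sigma-algebra of the first [n] variables. Full rectangles are taken, rather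
    than single preimages, for stability under intersection. *)
Definition cylinders (X : nat -> T -> R) (n : nat) : set (set T) :=
  [set A | exists2 B : nat -> set R, (forall j, measurable (B j)) &
    A = \bigcap_(j in [set` iota 0 n]) (X j @^-1` B j)].

Lemma cylinders_indep (X : nat -> T -> R) n (A : set T) (C : set R) :
  (forall i, measurable_fun setT (X i)) -> mutually_independent P X ->
  measurable C -> <<s cylinders X n >> A ->
  P (A `&` X n @^-1` C) = P A * P (X n @^-1` C).
Proof.
move=> mX indX mC.
have mXC i B : measurable B -> measurable (X i @^-1` B).
  by move=> mB; rewrite -[_ @^-1` _]setTI; exact: mX.
apply: indep_g_sigma_algebra => //.
- move=> _ [B mB ->]; by apply: bigcap_measurableType => j _; exact: mXC.
- move=> _ _ [B mB ->] [B' mB' ->]; exists (fun j => B j `&` B' j).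
    by move=> j; exact: measurableI.
  by rewrite -bigcapI.
- by exists (fun=> setT) => //; apply/seteqP; split.
- exact: mXC.
- move=> _ [B mB ->].
  (* Extending the rectangle by [C] at index [n] lets mutual independence be applied to [n.+1] and
     to [n] variables and the results compared. *)
  pose B' j := if (j < n)%N then B j else C.
  have B'n : B' n = C by rewrite /B' ltnn.
  have mB' j : measurable (B' j) by rewrite /B'; case: ifP.
  have eqB j : j \in iota 0 n -> B' j = B j.
    by rewrite mem_iota /B' => /= ->.
  have := indX (iota 0 n.+1) B' (iota_uniq _ _) (fun j _ => mB' j).
  rewrite -addn1 iotaD add0n /= big_cat big_seq1 /= B'n.
  rewrite -(indX (iota 0 n) B' (iota_uniq _ _) (fun j _ => mB' j)).
  have -> : \bigcap_(j in [set` iota 0 n]) (X j @^-1` B' j) =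
            \bigcap_(j in [set` iota 0 n]) (X j @^-1` B j).
    by apply: eq_bigcapr => j /= /eqB ->.
  move=> <-; congr (P _).
  apply/seteqP; split => x.
    move=> [h hn] j; rewrite /= mem_cat mem_seq1 => /orP[jn|/eqP ->].
      by rewrite eqB //; exact: h.
    by rewrite B'n.
  move=> h; split => [j /= jn|].
    by rewrite -eqB //; apply: h; rewrite /= mem_cat jn.
  by rewrite -B'n; apply: h; rewrite /= mem_cat mem_seq1 eqxx orbT.
Qed.

End independence.

(** * Ville's maximal inequality by stopping *)

Section ville.
Context {R : realType} {d : measure_display} {T : measurableType d}.
Context (P : probability T R) (X : nat -> T -> R) (phi : nat -> R -> R) (lam : R).

(* The process [\prod_(i < n) phi i (X i x)] stopped when it first reaches [lam]. *)
Fixpoint stopped (n : nat) (x : T) : R :=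
  if n is k.+1 then
    if lam <= stopped k x then stopped k x else stopped k x * phi k (X k x)
  else 1.

Lemma stopped_prod n x : stopped n x < lam ->
  stopped n x = \prod_(i < n) phi i (X i x).
Proof.
elim: n => [|n IH] /=; first by rewrite big_ord0.
rewrite big_ord_recr/=; case: ifPn => [lamZ|]; first by rewrite ltNge lamZ.
by rewrite -ltNge => /IH ->.
Qed.

Hypothesis phi0 : forall n y, 0 <= phi n y.

Lemma stopped_ge0 n x : 0 <= stopped n x.
Proof. by elim: n => //= n IH; case: ifP => // _; rewrite mulr_ge0. Qed.

Hypothesis mphi : forall n, measurable_fun setT (phi n).

(** The map [c] allows another sigma-algebra on the source: besides the given one, the one generated
    by the past is needed. *)
Lemma measurable_stopped {d'} (C : measurableType d') (c : C -> T) n :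
  (forall i, (i < n)%N -> measurable_fun setT (X i \o c)) ->
  measurable_fun setT (stopped n \o c).
Proof.
elim: n => [|n IH] mX; first exact: measurable_cst.
have mZ : measurable_fun setT (stopped n \o c).
  by apply: IH => i /ltnW; exact: mX.
apply: measurable_fun_ifT => //.
  by apply: measurable_fun_ler => //; exact: measurable_cst.
apply: measurable_funM => //; apply: (measurableT_comp (mphi n)).
exact: mX.
Qed.

Hypothesis mX : forall n, measurable_fun setT (X n).
Hypothesis indX : mutually_independent P X.
Hypothesis phi1 : forall n, (\int[P]_x (phi n (X n x))%:E <= 1)%E.

Lemma stopped_le1 n : (\int[P]_x (stopped n x)%:E <= 1)%E.
Proof.
have mZ : measurable_fun setT (stopped n).
  by apply: (@measurable_stopped _ T id) => i _; exact: mX.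
elim: n mZ => [|n IH] mZS /=; first by rewrite integral_cst //= probability_setT mule1.
have mZ : measurable_fun setT (stopped n).
  by apply: (@measurable_stopped _ T id) => i _; exact: mX.
apply: le_trans (IH mZ).
pose h1 (z : R) := if lam <= z then z else 0.
pose h2 (z : R) := if lam <= z then 0 else z.
have mh1 : measurable_fun setT h1.
  by apply: measurable_fun_ifT => //; apply: measurable_fun_ler.
have mh2 : measurable_fun setT h2.
  by apply: measurable_fun_ifT => //; apply: measurable_fun_ler.
have h1_ge0 z : 0 <= z -> 0 <= h1 z by rewrite /h1; case: ifP.
have h2_ge0 z : 0 <= z -> 0 <= h2 z by rewrite /h2; case: ifP.
have mphiX : measurable_fun setT (fun x => phi n (X n x)).
  exact: measurableT_comp.
have Z0 := stopped_ge0 n.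
have mEZ (h : R -> R) : measurable_fun setT h -> measurable_fun setT (fun x => (h (stopped n x))%:E).
  by move=> mh; apply/measurable_EFinP; exact: measurableT_comp.
have split_int (u : T -> R) : (forall x, 0 <= u x) -> measurable_fun setT u ->
    (\int[P]_x (h1 (stopped n x) + h2 (stopped n x) * u x)%:E =
     \int[P]_x (h1 (stopped n x))%:E + \int[P]_x (h2 (stopped n x) * u x)%:E)%E.
  move=> u0 mu; under eq_integral do rewrite EFinD.
  rewrite ge0_integralD //.
  - by move=> x _; rewrite lee_fin h1_ge0.
  - exact: mEZ.
  - by move=> x _; rewrite lee_fin mulr_ge0 ?h2_ge0.
  - by apply/measurable_EFinP; apply: measurable_funM => //; exact: measurableT_comp.
rewrite (_ : (fun x => _) = fun x =>
    (h1 (stopped n x) + h2 (stopped n x) * phi n (X n x))%:E); last first.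
  by apply/funext => x; rewrite /h1 /h2; case: ifP; rewrite ?mul0r ?addr0 ?add0r.
rewrite [leRHS](_ : _ = \int[P]_x (h1 (stopped n x) + h2 (stopped n x) * 1)%:E)%E; last first.
  apply: eq_integral => x _.
  by rewrite /h1 /h2; case: ifP; rewrite ?mul0r ?mulr1 ?addr0 ?add0r.
rewrite !split_int // leeD2l //.
under [leRHS]eq_integral do rewrite mulr1.
rewrite indep_integralM //.
- rewrite -[leRHS]mule1 lee_wpmul2l //.
  by apply: integral_ge0 => x _; rewrite lee_fin h2_ge0.
- exact: measurableT_comp.
- by move=> x; exact: h2_ge0.
- move=> A B mA mB.
  apply: (cylinders_indep P X n _ (phi n @^-1` B) mX indX).
    by rewrite -[X in measurable X]setTI; exact: mphi.
  (* It remains to see that the running part is measurable for the past: [C] is [T] with that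
     sigma-algebra, and a preimage under [X i], [i < n], is a rectangle with all other sides
     [setT]. *)
  pose C := g_sigma_algebraType (cylinders X n).
  have mZC : measurable_fun setT (h2 \o (stopped n \o (id : C -> T))).
    apply: measurableT_comp => //; apply: measurable_stopped => i ltin _ D mD.
    rewrite setTI; apply: sub_sigma_algebra.
    exists (fun j => if j == i then D else setT).
      by move=> j; case: ifP.
    apply/seteqP; split => x /=.
      by move=> Dx j _ /=; case: eqP => // ->.
    by move/(_ i); rewrite /= mem_iota /= eqxx; apply.
  by have := mZC measurableT A mA; rewrite setTI.
Qed.

(** Markov's inequality bounds each event [E n]. Freezing makes these events increase with [n], so
    continuity from below carries the bound to their union. *)
Lemma ville : 0 < lam ->
  (P (\bigcup_n [set x | (lam <= \prod_(i < n) phi i (X i x))%R]) <= (lam^-1)%:E)%E.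
Proof.
move=> lam0.
have mZ n : measurable_fun setT (stopped n).
  by apply: (@measurable_stopped _ T id) => i _; exact: mX.
pose E n := [set x | lam <= stopped n x].
have mE n : measurable (E n).
  rewrite (_ : E n = stopped n @^-1` `[lam, +oo[%classic).
    by rewrite -[X in measurable X]setTI; apply: mZ.
  by apply/seteqP; split=> x /=; rewrite /E/= in_itv/= andbT.
have PE n : (P (E n) <= (lam^-1)%:E)%E.
  rewrite -[E n]setIT -integral_indic //.
  apply: (@le_trans _ _ (\int[P]_x ((lam^-1)%:E * (stopped n x)%:E))%E).
    apply: ge0_le_integral => //.
    - by apply/measurable_EFinP; exact: measurable_indic.
    - by apply/measurable_EFinP; exact: measurable_funM.
    - move=> x _; rewrite -EFinM lee_fin indicE mulrC ler_pdivlMr //.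
      case: (boolP (x \in E n)) => [|_]; last by rewrite mul0r stopped_ge0.
      by rewrite inE mul1r.
  have lamV : 0 <= lam^-1 by rewrite invr_ge0 ltW.
  rewrite ge0_integralZl_EFin //.
  - by rewrite -[leRHS]mule1 lee_wpmul2l // ?stopped_le1.
  - by move=> x _; rewrite lee_fin stopped_ge0.
  - by apply/measurable_EFinP.
have ndE : nondecreasing_seq E.
  apply/nondecreasing_seqP => n; apply/subsetPset => x.
  by rewrite /E/= => lamZ; rewrite lamZ.
have mUE : measurable (\bigcup_n E n) by exact: bigcupT_measurable.
apply: (@le_trans _ _ (P (\bigcup_n E n))).
  rewrite le_measure ?inE //.
    apply: bigcupT_measurable => n; rewrite -[X in measurable X]setTI.
    by apply: measurable_fun_le => //; apply: measurable_prod => i _; exact: measurableT_comp.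
  move=> x [n _ /= lamY]; exists n => //; rewrite /E/= leNgt; apply/negP => Zlam.
  by move: lamY; rewrite -stopped_prod // leNgt Zlam.
by apply: cvge_le (nondecreasing_cvg_mu mE mUE ndE); exact: nearW.
Qed.
End ville.

(** * The optimal parameter and the final bound *)

Lemma bennett_optimum {R : realType} (b v eps : R) : 0 < b -> 0 < v -> 0 < eps < b ->
  let zeta := b / (b ^+ 2 + v) * ln ((1 + eps * b / v) / (1 - eps / b)) in
  bennett b zeta v * expR (- (eps * zeta)) =
  (1 + b * eps / v) `^ (- ((v + b * eps) / (b ^+ 2 + v))) *
  (1 - eps / b) `^ (- ((b ^+ 2 - b * eps) / (b ^+ 2 + v))).
Proof.
move=> b0 v0 /andP[e0 eb] zeta.
have D0 : 0 < 1 - eps / b by rewrite subr_gt0 ltr_pdivrMr // mul1r.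
have A0 : 0 < 1 + b * eps / v by rewrite ltr_pwDl // divr_ge0 ?mulr_ge0 // ltW.
have bv : 0 < b ^+ 2 + v by rewrite addr_gt0 // exprn_gt0.
set A := 1 + b * eps / v in A0 *; set D := 1 - eps / b in D0 *.
have zetaE : zeta = b / (b ^+ 2 + v) * (ln A - ln D).
  by rewrite /zeta (mulrC eps) ln_div ?posrE.
(* The choice of [zeta] fixes the ratio of the exponentials at the two atoms; with
   [b ^+ 2 * D + v * A = b ^+ 2 + v] their mean collapses to one term. *)
have expAD : expR ((b + v / b) * zeta) = A / D.
  rewrite -[RHS]lnK ?posrE ?divr_gt0 // ln_div ?posrE // zetaE.
  by congr expR; field; rewrite !gt_eqF.
have -> : bennett b zeta v = expR (- (v / b) * zeta) / D.
  rewrite /bennett (_ : b * zeta = - (v / b) * zeta + (b + v / b) * zeta); last by ring.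
  rewrite [expR (_ + _)]expRD expAD; set E := expR _.
  suff h : b ^+ 2 * D + v * A = b ^+ 2 + v.
    have -> : E / D = E / D * ((b ^+ 2 * D + v * A) / (b ^+ 2 + v)).
      by rewrite h divff ?mulr1 ?gt_eqF.
    by field; rewrite !gt_eqF.
  by rewrite /A /D; field; rewrite !gt_eqF.
rewrite /powR !gt_eqF // -{1}(@lnK _ D) ?posrE // -expRN -!expRD.
by congr expR; rewrite zetaE; field; rewrite !gt_eqF.
Qed.

(* X i stands for X_{i+1}, sigma i for sigma_{i+1}; S_n = \sum_(i < n) X i. *)
Theorem theorem16 (R : realType) (d : measure_display) (T : measurableType d)
  (P : probability T R) (X : nat -> {RV P >-> R}) (sigma : nat -> R) (b : R)
  (m : nat) (eps : R) :
  0 < b ->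
  mutually_independent P (fun i => X i : T -> R) ->
  (forall i, ('E_P[X i] = 0)%E) ->
  (forall i, (\int[P]_x ((`|X i x| ^+ 2)%:E) <= (sigma i ^+ 2)%:E)%E) ->
  (forall i, {ae P, forall x, X i x <= b}) ->
  (0 < m)%N -> 0 < nu sigma m ->
  0 < eps < b ->
  let num := nu sigma m in
  let zeta := b / (b ^+ 2 + num) * ln ((1 + eps * b / num) / (1 - eps / b)) in
  (P [set x | (0 <= ereal_sup [set (zeta * ((\sum_(i < n) X i x) - m%:R * eps)
                     - calV b sigma zeta n + calV b sigma zeta m)%:E
                   | n in [set n : nat | (0 < n)%N]])%E]
   <= (((1 + b * eps / num) `^ (- ((num + b * eps) / (b ^+ 2 + num))) *
        (1 - eps / b) `^ (- ((b ^+ 2 - b * eps) / (b ^+ 2 + num)))) ^+ m)%:E)%E.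
Proof.
move=> b0 indX EX EX2 Xb m0 num0 eps0b.
cbv zeta; set num := nu sigma m in num0 *.
set zeta := b / (b ^+ 2 + num) * ln _.
have /andP[e0 eb] := eps0b.
have zeta0 : 0 < zeta.
  rewrite mulr_gt0 ?divr_gt0 ?addr_gt0 ?exprn_gt0 // ln_gt0 //.
  have D0 : 0 < 1 - eps / b by rewrite subr_gt0 ltr_pdivrMr // mul1r.
  rewrite ltr_pdivlMr // mul1r (@lt_trans _ _ 1) //.
    by rewrite gtrBl divr_gt0.
  by rewrite ltrDl divr_gt0 // mulr_gt0.
pose V := calV b sigma zeta.
(* Normalising by increments of [V] makes the product telescope to [expR (zeta * S_n - V n)],
   because [V 0 = 0]. *)
pose phi i (y : R) := expR (zeta * y - (V i.+1 - V i)).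
pose f n x : R := zeta * ((\sum_(i < n) X i x) - m%:R * eps) - V n + V m.
have prodE n x : \prod_(i < n) phi i (X i x) = expR (f n x + m%:R * (eps * zeta) - V m).
  rewrite -expR_sum; congr expR.
  rewrite big_split/= -mulr_sumr sumrN -(big_mkord xpredT (fun i => V i.+1 - V i)).
  rewrite telescope_sumr // /f.
  have -> : V 0%N = 0 by rewrite /V /calV mul0r.
  ring.
have mphi n : measurable_fun setT (phi n).
  by apply: measurableT_comp => //; exact: measurable_funB.
have phi1 n : (\int[P]_x (phi n (X n x))%:E <= 1)%E.
  have B0 := bennett_gt0 b zeta b0 _ (sqr_ge0 (sigma n)).
  under eq_integral do rewrite /phi addrC expRD EFinM.
  rewrite ge0_integralZl_EFin ?expR_ge0 //; last first.
  - by apply/measurable_EFinP; apply: measurableT_comp => //; exact: measurable_funM.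
  have := mgf_le_bennett P (X n) b zeta _ b0 zeta0 (EX n) (EX2 n) (Xb n).
  move=> /(lee_wpmul2l _) => /(_ (expR (- (V n.+1 - V n)))%:E).
  rewrite lee_fin expR_ge0 => /(_ isT) /le_trans; apply.
  rewrite -EFinM lee_fin -[bennett _ _ _]lnK ?posrE // -expRD -expR0 ler_expR.
  have := calV_increment b zeta b0 (ltW zeta0) sigma n; rewrite -/V; lra.
set bound := (_ * _) ^+ m.
have boundE : bound = expR (V m - m%:R * (eps * zeta)).
  rewrite /bound -bennett_optimum // exprMn -expRM_natl mulrN expRD; congr (_ * _).
  by rewrite /V /calV -/(bennett b zeta num) expRM_natl lnK // posrE bennett_gt0 // ltW. 
have bound0 : 0 < bound by rewrite boundE expR_gt0.
have mf n : measurable_fun setT (f n).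
  apply: measurable_funD => //; apply: measurable_funB => //.
  apply: measurable_funM => //; apply: measurable_funB => //.
  exact: measurable_sum.
apply/lee_addgt0Pr => eta eta0.
(* A supremum equal to 0 need not be attained, so the level is lowered by a factor [r > 1], chosen
   so that [bound * r = bound + eta]. *)
pose r := 1 + eta / bound.
have r1 : 1 < r by rewrite ltrDl divr_gt0.
have r0 : 0 < r by exact: lt_trans r1.
pose lam := (bound * r)^-1.
have lam0 : 0 < lam by rewrite invr_gt0 mulr_gt0.
have := ville P (fun i => X i : T -> R) phi lam _ mphi _ indX phi1 lam0.
rewrite invrK => H.
have -> : (bound%:E + eta%:E = (bound * r)%:E)%E.
  by rewrite -EFinD /r; congr EFin; field; rewrite gt_eqF.
apply: le_trans (H _ _) => //; last by move=> *; exact: expR_ge0.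
rewrite le_measure ?inE //.
- rewrite -[X in measurable X]setTI.
  apply: measurable_lee => //.
  apply: (measurable_fun_esups (f := fun n x => (f n x)%:E) _ 1%N) => n.
  exact/measurable_EFinP.
- apply: bigcupT_measurable => n; rewrite -[X in measurable X]setTI.
  by apply: measurable_fun_le => //; apply: measurable_prod => i _; exact: measurableT_comp.
- move=> x /= sup0.
  (* The supremum strictly exceeds [- ln r], so some [f n x] does too, and the product then reaches
     [lam] at this [n]. *)
  have : ((- ln r)%:E < ereal_sup [set (f n x)%:E | n in [set n : nat | (0 < n)%N]])%E.
    by apply: lt_le_trans sup0; rewrite lte_fin oppr_lt0 ln_gt0.
  move=> /ereal_sup_gt[_ [n _ <-]]; rewrite lte_fin => fn.
  exists n => //=; rewrite prodE.
  have -> : lam = expR (- ln r + m%:R * (eps * zeta) - V m).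
    rewrite /lam boundE -{1}(@lnK _ r) ?posrE // -expRD -expRN; congr expR; ring.
  by rewrite ler_expR; lra.
Qed.
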